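(* If $G$ is an $n$-vertex graph with minimum degree at least $0.999n$, then $G$ is total weight $(1,4)$-choosable.
   Context: Graphs are finite and simple. For a graph $G=(V,E)$ and a vertex $i\in V$, let $E(i)$ denote the set of edges incident to $i$. A total weighting of $G$ is a mapping $\phi: V\cup E\to\mathbb{R}$; it is proper if for every edge $\{i,j\}\in E$, $\sum_{e\in E(i)}\phi(e)+\phi(i)\neq \sum_{e\in E(j)}\phi(e)+\phi(j)$. For positive integers $k,k'$, $G$ is total weight $(k,k')$-choosable if for every assignment $L$ of a set $L(v)$ of $k$ real numbers to each vertex $v\in V$ and a set $L(e)$ of $k'$ real numbers to each edge $e\in E$, there is a proper total weighting $\phi$ of $G$ with $\phi(z)\in L(z)$ for all $z\in V\cup E$. *)

(* Defs.v *)
From HB Require Import structures.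
From mathcomp Require Import all_boot all_order all_algebra.
From mathcomp Require Import finmap reals.

Set Implicit Arguments.
Unset Strict Implicit.
Unset Printing Implicit Defensive.

Import Order.TTheory GRing.Theory Num.Theory.
Local Open Scope ring_scope.

Record sgraph (V : finType) := SGraph {
  adj :> rel V;
  adj_sym : symmetric adj;
  adj_irrefl : irreflexive adj }.

Definition edges (V : finType) (G : sgraph V) : {set {set V}} :=
  [set [set p.1; p.2] | p : V * V & adj G p.1 p.2].

Definition edge (V : finType) (G : sgraph V) : finType :=
  {e : {set V} | e \in edges G}.

Definition incident (V : finType) (G : sgraph V) (i : V) : {set edge G} :=
  [set e : edge G | i \in val e].

Definition degree (V : finType) (G : sgraph V) (i : V) : nat :=
  #|incident G i|.

(* The default value #|V| exceeds every degree, so it does not affect the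
   minimum unless V is empty. *)
Definition min_degree (V : finType) (G : sgraph V) : nat :=
  \big[minn/#|V|]_(i : V) degree G i.

Definition total_weighting (R : realType) (V : finType) (G : sgraph V) : Type :=
  V + edge G -> R.

Definition weight_sum (R : realType) (V : finType) (G : sgraph V)
    (phi : total_weighting R G) (i : V) : R :=
  (\sum_(e in incident G i) phi (inr e)) + phi (inl i).

Definition proper (R : realType) (V : finType) (G : sgraph V)
    (phi : total_weighting R G) : Prop :=
  forall i j : V, adj G i j -> weight_sum phi i <> weight_sum phi j.

Definition total_weight_choosable (R : realType) (V : finType) (G : sgraph V)
    (k k' : nat) : Prop :=
  forall L : V + edge G -> {fset R},
    (forall v : V, #|` L (inl v)| = k) ->
    (forall e : edge G, #|` L (inr e)| = k') ->
    exists phi : total_weighting R G,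
      proper phi /\ (forall z : V + edge G, phi z \in L z).

(* Main.v *)
(* Write x_e for the weight of an edge and y_v for a variable at the vertex v.
   By the Combinatorial Nullstellensatz it suffices that the top homogeneous part
   of P = \prod_(uv) (S_u - S_v), S_u the weight sum at u, contains a monomial in
   which every x_e has exponent at most 3. Up to factorials, its coefficient is
   the permanent of a matrix whose columns are columns of the incidence map.
   If every edge uv is given a common neighbour c(uv), then x_(uc) - x_(vc) is
   mapped to y_u - y_v by x_(ab) |-> y_a + y_b, so pairing the top part of P with
   \prod_(uv) (x_(uc) - x_(vc)) gives the squared norm of \prod_(uv) (y_u - y_v),
   which is positive. Hence some monomial of \prod_(uv) (x_(uc) - x_(vc)) occurs
   in P, and it only remains to choose c so that no edge is used more than three
   times as uc or vc.
   To this end identify V with Z/n and put c(uv) = u + v, which uses every edge at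
   most twice. This fails only at the edges uv for which u or v is not adjacent
   to u + v; few vertices (forming the set Z) meet many of them. The failing
   edges and all edges at Z are recoloured greedily, those inside Z first. *)

Require Import Defs.
From HB Require Import structures.
From mathcomp Require Import all_boot all_order all_algebra all_fingroup.
From mathcomp Require Import finmap reals.
From mathcomp Require Import zify ring lra.

Set Implicit Arguments.
Unset Strict Implicit.
Unset Printing Implicit Defensive.

Import Order.TTheory GRing.Theory Num.Theory.
Local Open Scope ring_scope.

(** * Permanents and a Combinatorial Nullstellensatz on finite grids *)

(** Up to factorials, the [perm_coef f] are the coefficients of the product of the linear forms
    [g i], and the sum over [s] is a positive multiple of the sum of their squares. If it vanished,
    so would the product at [y]. *)
Lemma gram_permanent_neq0 (R : realFieldType) (I V : finType) (g : I -> V -> R)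
    (y : V -> R) :
  \prod_i \sum_v g i v * y v != 0 ->
  \sum_(s : {perm I}) \prod_i \sum_v g (s i) v * g i v != 0.
Proof.
move=> gy_neq0.
pose perm_coef (f : {ffun I -> V}) := \sum_(s : {perm I}) \prod_i g (s i) (f i).
set S := \sum_s _.
have sum_sq : S *+ #|{perm I}| = \sum_f perm_coef f ^+ 2.
  transitivity (\sum_(t : {perm I}) \sum_(s : {perm I})
                  \prod_i \sum_v g (s i) v * g (t i) v).
    rewrite -sumr_const; apply: eq_bigr => t _.
    rewrite /S (reindex_inj (mulgI t^-1%g)); apply: eq_bigr => s _.
    rewrite (reindex_inj (@perm_inj _ t)); apply: eq_bigr => i _.
    by rewrite permM permK.
  under eq_bigr do under eq_bigr do rewrite bigA_distr_bigA.
  under eq_bigr do rewrite exchange_big.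
  rewrite exchange_big; apply: eq_bigr => f _.
  rewrite expr2 mulr_suml exchange_big; apply: eq_bigr => s _.
  rewrite mulr_sumr; apply: eq_bigr => t _.
  by rewrite -big_split.
apply: contra_neq gy_neq0 => S0.
have coef0 f : perm_coef f = 0.
  apply/eqP; rewrite -sqrf_eq0.
  have := sum_sq; rewrite S0 mul0rn => /esym /eqP.
  rewrite psumr_eq0 => [|? _]; last exact: sqr_ge0.
  by move/allP => /(_ f); rewrite mem_index_enum => /(_ isT).
apply/eqP; have : (\prod_i \sum_v g i v * y v) *+ #|{perm I}| == 0.
  rewrite -sumr_const.
  rewrite (eq_bigr (fun s : {perm I} =>
    \sum_(f : {ffun I -> V}) \prod_i (g (s i) (f i) * y (f i)))); last first.
    move=> s _; rewrite (reindex_inj (@perm_inj _ s)) bigA_distr_bigA /=.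
    by [].
  rewrite exchange_big big1 // => f _.
  under eq_bigr do rewrite big_split.
  by rewrite -mulr_suml -/(perm_coef f) coef0 mul0r.
by rewrite mulrn_eq0 => /orP[/eqP/card0_eq/(_ 1%g)|].
Qed.

(** Inverting the Vandermonde matrix turns evaluation at [N] distinct points into extraction of one
    coefficient of a polynomial of degree below [N]. *)
Lemma vandermonde_dual (R : fieldType) (N : nat) (a : 'I_N -> R) (k : 'I_N) :
  injective a ->
  exists mu : 'I_N -> R,
    forall j : 'I_N, \sum_i mu i * a i ^+ j = (j == k)%:R.
Proof.
move=> a_inj; pose W := Vandermonde N (\row_i a i).
have W_unit : W \in unitmx.
  rewrite unitmxE unitfE det_Vandermonde.
  apply/prodf_neq0 => i _; apply/prodf_neq0 => j ltij.
  rewrite !mxE subr_eq0; apply: contraTneq ltij => /a_inj ->.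
  by rewrite ltnn.
exists (fun i => (invmx W *m delta_mx k (ord0 : 'I_1)) i ord0) => j.
transitivity ((W *m (invmx W *m delta_mx k (ord0 : 'I_1))) j ord0).
  by rewrite [RHS]mxE; apply: eq_bigr => i _; rewrite !mxE mulrC.
by rewrite mulKVmx // mxE eqxx andbT.
Qed.

Lemma fiber_card_permP (I E : finType) (f s : I -> E) :
  (forall e, #|[set i | f i == e]| = #|[set i | s i == e]|) ->
  exists t : {perm I}, forall i, f i = s (t i).
Proof.
move=> eq_card.
have cnt (h : I -> E) e : count_mem e [seq h i | i <- enum I] = #|[set i | h i == e]|.
  rewrite count_map cardE /enum_mem size_filter -enumT count_filter.
  by apply: eq_count => i /=; rewrite !inE andbT.
have szE : size (enum I) == #|I| by rewrite cardE.
have : perm_eq [seq f i | i <- enum I] (map_tuple s (Tuple szE)).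
  by apply/allP => e _ /=; rewrite !cnt eq_card.
case/tuple_permP => p def_f.
have q_inj : injective (fun i => enum_val (p (enum_rank i))).
  exact: inj_comp enum_val_inj (inj_comp (@perm_inj _ p) enum_rank_inj).
exists (perm q_inj) => i; rewrite permE.
have := congr1 (fun l => nth (f i) l (enum_rank i)) def_f.
rewrite (nth_map i) ?nth_enum_rank -?cardE // => ->.
rewrite -(tnth_nth (f i) [tuple _ | i < _] (enum_rank i)) tnth_mktuple tnth_map.
by rewrite (tnth_nth i) (enum_val_nth i).
Qed.

Lemma sum_card_fibers (I E : finType) (h : I -> E) :
  (\sum_e #|[set i | h i == e]| = #|I|)%N.
Proof.
rewrite -sum1_card (partition_big h predT) //=.
by apply: eq_bigr => e _; rewrite sum1dep_card.
Qed.

(* Pairing [P] with the tensor product of the functionals dual to [x_e ^ K_e],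
   [K_e] the size of the fiber of [s] over [e], kills every monomial in
   [\prod_i (b i + \sum_e A i e x_e)] other than [\prod_e x_e ^ K_e], whose
   coefficient is a nonzero multiple of the permanent. *)
Lemma permanent_nullstellensatz (R : numFieldType) (I E : finType) (N : nat)
    (A : I -> E -> R) (b : I -> R) (a : E -> 'I_N -> R) (s : I -> E) :
    (forall e, injective (a e)) ->
    (forall e, #|[set i | s i == e]| < N)%N ->
    \sum_(t : {perm I}) \prod_i A (t i) (s i) != 0 ->
  exists k : {ffun E -> 'I_N}, forall i, b i + \sum_e A i e * a e (k e) != 0.
Proof.
move=> a_inj ltKN per_neq0.
pose P (k : {ffun E -> 'I_N}) := \prod_i (b i + \sum_e A i e * a e (k e)).
have [k /prodf_neq0 Pk | P0] := pickP (fun k => P k != 0).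
  by exists k => i; apply: Pk.
case/eqP: per_neq0.
(* [None] marks the choice of the constant term [b i] in the [i]-th factor. *)
pose cnt (f : {ffun I -> option E}) e := #|[set i | f i == Some e]|.
pose K e := #|[set i | s i == e]|.
have [mu muE] : exists mu : E -> 'I_N -> R, forall e (j : 'I_N),
    \sum_i mu e i * a e i ^+ j = (j == K e :> nat)%:R.
  have := fun e => vandermonde_dual (Ordinal (ltKN e)) (a_inj e).
  by case/fin_all_exists => mu muE; exists mu => e j; rewrite muE.
have sum_cnt (f : {ffun I -> option E}) :
    (#|[set i | f i == None]| + \sum_e cnt f e = \sum_e K e)%N.
  rewrite sum_card_fibers -(sum_card_fibers f) (bigD1 None) //=; congr (_ + _)%N.
  by rewrite [RHS](reindex_omap Some id) => [|[]] //=; apply: eq_bigl => e; rewrite eqxx.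
pose coef (f : {ffun I -> option E}) :=
  \prod_i (if f i is Some e then A i e else b i).
have P_expand k : P k = \sum_f coef f * \prod_e a e (k e) ^+ cnt f e.
  transitivity (\prod_i \sum_(o : option E)
     (if o is Some e then A i e else b i) * (if o is Some e then a e (k e) else 1)).
    apply: eq_bigr => i _.
    rewrite (bigD1 None) //= mulr1; congr (_ + _).
    rewrite [RHS](reindex_omap Some id) => [|[]] //=.
    by apply: eq_bigl => e; rewrite eqxx.
  rewrite bigA_distr_bigA; apply: eq_bigr => f _.
  rewrite big_split; congr (_ * _).
  under [RHS]eq_bigr do rewrite /cnt -prodr_const big_mkcond /=.
  rewrite exchange_big; apply: eq_bigr => i _ /=.
  case fi: (f i) => [e|]; last by rewrite big1 // => e _; rewrite inE fi.
  rewrite (bigD1 e) //= inE fi eqxx big1 ?mulr1 // => e' neq.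
  by rewrite inE fi (inj_eq Some_inj) eq_sym (negPf neq).
have pairing_eq0 : \sum_(f | [forall e, cnt f e == K e]) coef f = 0.
  have : \sum_(k : {ffun E -> 'I_N}) (\prod_e mu e (k e)) * P k = 0.
    by apply: big1 => k _; move/negbFE/eqP: (P0 k) => ->; rewrite mulr0.
  under eq_bigr do rewrite P_expand mulr_sumr.
  rewrite exchange_big /= => sum0; rewrite -[RHS]sum0 big_mkcond /=.
  apply: eq_bigr => f _.
  under [RHS]eq_bigr do rewrite mulrCA -big_split.
  rewrite -mulr_sumr /=.
  rewrite -(bigA_distr_bigA (fun e j => mu e j * a e j ^+ cnt f e)).
  have [/forallP eqK | /forallPn neqK] := ifPn.
    rewrite big1 ?mulr1 // => e _.
    by rewrite (eqP (eqK e)) (muE e (Ordinal (ltKN e))) eqxx.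
  (* Exponents may reach [N], where [muE] says nothing. But the total degree is at most
     [\sum_e K e], so a wrong monomial has an exponent below some [K e], and [mu e] kills it. *)
  have [e lt_cntK] : exists e, (cnt f e < K e)%N.
    case: neqK => e0 neq; have [e //| geq] := pickP (fun e => cnt f e < K e)%N.
      by exists e.
    have: (\sum_e K e <= \sum_e cnt f e ?= iff [forall e, K e == cnt f e])%N.
      apply: leqif_sum => e _; split=> //.
      by rewrite leqNgt geq.
    case=> leKcnt eqE; have /forallP eqK : [forall e, K e == cnt f e].
      by rewrite -eqE eqn_leq leKcnt -(sum_cnt f) leq_addl.
    by rewrite eq_sym eqK in neq.
  rewrite (bigD1 e) //= (muE e (Ordinal (ltn_trans lt_cntK (ltKN e)))) /=.
  by rewrite ltn_eqF // mul0r mulr0.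
pose F (t : {perm I}) : {ffun I -> option E} := [ffun i => Some (s (t i))].
have cntF t e : cnt (F t) e = K e.
  rewrite /K -(card_imset _ (@perm_inj _ t^-1%g)); apply: eq_card => i.
  rewrite inE ffunE -[i in RHS](permK t) mem_imset; last exact: perm_inj.
  by rewrite inE.
transitivity (\sum_t coef (F t)).
  rewrite (reindex_inj invg_inj); apply: eq_bigr => t _.
  rewrite (reindex_inj (@perm_inj _ t)); apply: eq_bigr => i _.
  by rewrite permK ffunE.
rewrite (partition_big F (fun f => [forall e, cnt f e == K e])) => [|t _]; last first.
  by apply/forallP => e; rewrite cntF.
(* The fibres of [F] are cosets of the stabiliser of [s], hence equal in size. *)
transitivity (\sum_(f | [forall e, cnt f e == K e]) coef f *+ #|[pred t | F t == F 1%g]|);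
  last by rewrite sumrMnl pairing_eq0 mul0rn.
apply: eq_bigr => f /forallP eqK.
transitivity (\sum_(t | F t == f) coef f); first by apply: eq_bigr => t /eqP->.
rewrite sumr_const; congr (_ *+ _).
have [u fu] : exists u : {perm I}, forall i, f i = Some (s (u i)).
  apply: (@fiber_card_permP _ _ f (Some \o s)) => -[e|]; first exact/eqP/eqK.
  rewrite [RHS]eq_card0 => [|i]; last by rewrite inE.
  apply/eqP; rewrite -(eqn_add2r (\sum_e cnt f e)) sum_cnt add0n.
  by apply/eqP/eq_bigr => e _; rewrite (eqP (eqK e)).
have -> : f = F u by apply/ffunP => i; rewrite ffunE fu.
have F_mul t : (F (u * t)%g == F u) = (F t == F 1%g).
  apply/eqP/eqP => eqF; apply/ffunP => i.
    have := congr1 (fun h : {ffun I -> option E} => h (u^-1%g i)) eqF.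
    by rewrite !ffunE permM permKV perm1.
  have := congr1 (fun h : {ffun I -> option E} => h (u i)) eqF.
  by rewrite !ffunE permM perm1.
rewrite -(card_imset _ (mulgI u^-1%g)); apply: eq_card => t.
rewrite -[t in LHS](mulKg u) mem_imset; last exact: mulgI.
exact: F_mul.
Qed.

(* [x_(p i) - x_(q i)] is the preimage of the [i]-th factor [g i] under the
   transpose of the incidence map, so the Gram permanent of [g] is a signed sum
   of permanents to which [permanent_nullstellensatz] applies. *)
Lemma gram_nullstellensatz (R : realFieldType) (I E V : finType) (N : nat)
    (g : I -> V -> R) (y : V -> R) (A : I -> E -> R) (b : I -> R)
    (a : E -> 'I_N -> R) (p q : I -> E) :
    (forall e, injective (a e)) ->
    \prod_i \sum_v g i v * y v != 0 ->
    (forall i j, \sum_v g i v * g j v = A i (p j) - A i (q j)) ->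
    (forall e, #|[set i | (p i == e) || (q i == e)]| < N)%N ->
  exists k : {ffun E -> 'I_N}, forall i, b i + \sum_e A i e * a e (k e) != 0.
Proof.
move=> a_inj gy_neq0 gramE load_lt.
(* Whatever [beta] chooses, the fibre of [sel beta] over [e] lies in the set bounded by
   [load_lt]. *)
pose sel (beta : {ffun I -> bool}) i := if beta i then p i else q i.
have [beta per_neq0] : exists beta,
    \sum_(t : {perm I}) \prod_i A (t i) (sel beta i) != 0.
  have [beta ?|per0] := pickP (fun beta =>
      \sum_(t : {perm I}) \prod_i A (t i) (sel beta i) != 0).
    by exists beta.
  case/eqP: (gram_permanent_neq0 gy_neq0).
  under eq_bigr do under eq_bigr do rewrite gramE.
  transitivity (\sum_(t : {perm I}) \sum_(beta : {ffun I -> bool})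
      (\prod_i (-1) ^+ (~~ beta i)) * \prod_i A (t i) (sel beta i)).
    apply: eq_bigr => t _.
    under [RHS]eq_bigr do rewrite -big_split.
    rewrite -(bigA_distr_bigA (fun i (c : bool) =>
      (-1) ^+ (~~ c) * A (t i) (if c then p i else q i))).
    by apply: eq_bigr => i _; rewrite big_bool /= mul1r mulN1r.
  rewrite exchange_big big1 //= => beta _.
  by rewrite -mulr_sumr (eqP (negbFE (per0 beta))) mulr0.
apply: permanent_nullstellensatz per_neq0 => // e.
apply: leq_ltn_trans (load_lt e); apply/subset_leq_card/subsetP => i.
by rewrite !inE /sel; case: (beta i) => ->; rewrite ?orbT.
Qed.

(** * Greedy recolouring with bounded loads *)

Local Open Scope nat_scope.

Lemma card_set_sum (T : finType) (P : pred T) : #|[set x | P x]| = \sum_x P x.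
Proof. by rewrite -sum1dep_card big_mkcond; apply: eq_bigr => x _; case: (P x). Qed.

Lemma markov_card (T : finType) (f : T -> nat) (k : nat) :
  k * #|[set x | k <= f x]| <= \sum_x f x.
Proof.
rewrite card_set_sum big_distrr; apply: leq_sum => x _ /=.
by case: (k <= f x) / idP => [|_]; rewrite ?muln1 ?muln0.
Qed.

Definition uses (V : finType) (c : V -> V -> option V) (a b : V) : nat :=
  #|[set y | c a y == Some b]|.

Lemma sum_uses (V : finType) (c : V -> V -> option V) (a : V) :
  \sum_b uses c a b = #|[set y | isSome (c a y)]|.
Proof.
rewrite card_set_sum; under eq_bigr do rewrite /uses card_set_sum.
rewrite exchange_big; apply: eq_bigr => y _ /=.
case: (c a y) => [b|]; last by rewrite big1.
rewrite (bigD1 b) //= eqxx big1 // => b' neq.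
by rewrite (inj_eq Some_inj) eq_sym (negPf neq).
Qed.

(* [c] colours part of the edges to be recoloured. [uses c a b + uses c b a] counts
   how often its triangles use the edge [ab]; the colours [u + v] that are kept use
   [ab] at most twice, and at most once when an end lies in [Z]. [T] caps twice
   the number of edges of a given colour. *)
Definition greedy_state (V : finType) (e F : rel V) (Z : {set V}) (T : nat)
    (c : V -> V -> option V) : Prop :=
  [/\ forall a y, c a y = c y a,
      forall a y b, c a y = Some b -> [&& F a y, e a b & b \notin Z],
      forall b, \sum_a uses c a b <= T &
      forall a b, uses c a b + uses c b a <= 1 + ((a \in Z) || (b \in Z))].

(** For [w] outside [Z], this leaves room for one more triangle on [aw] under the load bound of
    [greedy_state]. *)
Definition free_colour (V : finType) (Z : {set V}) (c : V -> V -> option V)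
    (a w : V) : bool :=
  uses c a w + uses c w a <= (a \in Z).

(** Giving [uv] the colour [w] adds load only to [uw] and [vw], one each. The cap needs a margin of
    two since [w] is then used from both [u] and [v]. *)
Lemma greedy_extend (V : finType) (e F : rel V) (Z : {set V}) (T : nat)
    (c : V -> V -> option V) (u v w : V) :
    irreflexive e -> symmetric F -> greedy_state e F Z T c ->
    u != v -> F u v -> ~~ c u v -> e u w -> e v w -> w \notin Z ->
    \sum_a uses c a w + 2 <= T -> free_colour Z c u w -> free_colour Z c v w ->
  exists c', greedy_state e F Z T c' /\
    forall x y, isSome (c' x y) = isSome (c x y) ||
      ((x == u) && (y == v) || (x == v) && (y == u)).
Proof.
move=> e_irr F_sym [c_sym c_val c_cap c_load] neq_uv Fuv cuv euw evw wZ capw fu fv.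
have neq_uw : u != w by apply: contraTneq euw => ->; rewrite e_irr.
have neq_vw : v != w by apply: contraTneq evw => ->; rewrite e_irr.
pose new x y := (x == u) && (y == v) || (x == v) && (y == u).
have new_sym x y : new x y = new y x by rewrite /new orbC ![(y == _) && _]andbC.
pose c' x y := if new x y then Some w else c x y.
have cvu : ~~ c v u by rewrite c_sym.
have usesE a b : uses c' a b = uses c a b + (((a == u) || (a == v)) && (b == w)).
  rewrite /uses !card_set_sum.
  have [->|neq_au] := eqVneq a u.
    rewrite [LHS](bigD1 v) // [in RHS](bigD1 v) //= /c' /new !eqxx /=.
    rewrite (inj_eq Some_inj) [w == b]eq_sym.
    case: (c u v) cuv => // _; rewrite add0n addnC; congr (_ + _).
    by apply: eq_bigr => y /negPf->; rewrite ?(eq_sym v u) (negPf neq_uv).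
  have [->|neq_av] := eqVneq a v.
    rewrite [LHS](bigD1 u) // [in RHS](bigD1 u) //= /c' /new !eqxx /= orbT.
    rewrite (inj_eq Some_inj) [w == b]eq_sym.
    case: (c v u) cvu => // _; rewrite add0n addnC; congr (_ + _).
    by apply: eq_bigr => y /negPf->; rewrite ?(eq_sym v u) (negPf neq_uv).
  by rewrite addn0; apply: eq_bigr => y _; rewrite /c' /new (negPf neq_au) (negPf neq_av).
exists c'; split; last first.
  by move=> x y; rewrite /c' -/(new x y); case: (new x y); rewrite ?orbT ?orbF.
split.
- by move=> a y; rewrite /c' new_sym c_sym.
- move=> a y b; rewrite /c'; case: ifP => [|_]; last exact: c_val.
  by move=> /orP[] /andP[/eqP-> /eqP->] [<-]; rewrite ?Fuv ?(F_sym v) ?Fuv ?euw ?evw wZ.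
- move=> b; under eq_bigr do rewrite usesE.
  rewrite big_split /=; have [->|_] := eqVneq b w; last first.
    by rewrite [X in _ + X]big1 ?addn0 // => a _; rewrite andbF.
  apply: leq_trans capw; rewrite leq_add2l (bigD1 u) //= [X in _ + X](bigD1 v) 1?eq_sym
    //=.
  rewrite !eqxx orbT [X in _ + (_ + X)]big1 // => a /andP[/negPf-> /negPf->].
  by [].
- move=> a b; rewrite !usesE.
  have old := c_load a b; rewrite /free_colour in fu fv; move: old.
  have [->|bw] := eqVneq b w; have [->|aw] := eqVneq a w;
  rewrite ?[w == u]eq_sym ?[w == v]eq_sym ?(negPf neq_uw) ?(negPf neq_vw) /=
    ?andbF ?addn0 ?andbT //.
    have [->|] := eqVneq a u => /= _.
      by rewrite addnAC addn1 ltnS (leq_trans fu) //; case: (u \in Z).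
    have [->|] := eqVneq a v => //= old; last by rewrite addn0.
    by rewrite addnAC addn1 ltnS (leq_trans fv) //; case: (v \in Z).
  have [->|] := eqVneq b u => /= _.
    rewrite addnA addn1 ltnS addnC (leq_trans fu) //.
    by case: (u \in Z); rewrite ?orbT.
  have [->|] := eqVneq b v => //= old; last by rewrite addn0.
  rewrite addnA addn1 ltnS addnC (leq_trans fv) //.
  by case: (v \in Z); rewrite ?orbT.
Qed.

(** One round of recolouring: [c0] is the result of earlier rounds, [Q] the edges of this one. A
    step may rely on nothing outside [c0] and [Q] being coloured yet. *)
Lemma greedy_complete (V : finType) (e F Q : rel V) (Z : {set V}) (T : nat)
    (c0 : V -> V -> option V) :
    symmetric Q -> greedy_state e F Z T c0 ->
    (forall c u v, greedy_state e F Z T c ->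
       (forall x y, c0 x y -> c x y) -> (forall x y, c x y -> c0 x y || Q x y) ->
       Q u v -> ~~ c u v ->
     exists c', greedy_state e F Z T c' /\
       forall x y, isSome (c' x y) = isSome (c x y) ||
         ((x == u) && (y == v) || (x == v) && (y == u))) ->
  exists c, greedy_state e F Z T c /\
    forall x y, isSome (c x y) = c0 x y || Q x y.
Proof.
move=> Q_sym c0_state step.
suff [c [c_state c0c cQ done_c]] : exists c, [/\ greedy_state e F Z T c,
    forall x y, c0 x y -> c x y, forall x y, c x y -> c0 x y || Q x y &
    {in enum (predT : pred (V * V)), forall p, Q p.1 p.2 -> c p.1 p.2}].
  exists c; split=> // x y; apply/idP/orP => [/cQ/orP|[/c0c|]] //.
  by apply: (done_c (x, y)); rewrite mem_enum.
elim: (enum _) => [|[u v] s [c [c_state c0c cQ done_c]]].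
  by exists c0; split=> // x y ->.
have [[Quv cuv]|skip] : (Q u v /\ ~~ c u v) \/ (Q u v -> c u v).
  by case: (Q u v) (c u v) => [] [?|]; [right|left|right|right].
- have [c' [c'_state c'E]] := step c u v c_state c0c cQ Quv cuv.
  exists c'; split=> // [x y /c0c|x y|[x y]]; rewrite c'E ?inE.
  + by move=> ->.
  + case/orP=> [/cQ //|]; case/orP=> /andP[/eqP-> /eqP->]; rewrite ?(Q_sym v) Quv orbT //.
  + by case/predU1P=> [[-> ->]|/done_c/= h /h ->] //=; rewrite !eqxx orbT.
- exists c; split=> // p; rewrite inE => /predU1P[->|/done_c] //.
Qed.

Lemma card_setU_bound (V : finType) (B1 B2 B3 B4 B5 B6 : {set V}) :
    #|B1| + #|B2| + #|B3| + #|B4| + #|B5| + #|B6| < #|V| ->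
  exists w, [&& w \notin B1, w \notin B2, w \notin B3, w \notin B4,
      w \notin B5 & w \notin B6].
Proof.
move=> lt; pose B := B1 :|: (B2 :|: (B3 :|: (B4 :|: (B5 :|: B6)))).
have leB : #|B| < #|V|.
  apply: leq_ltn_trans lt; rewrite -!addnA.
  by do 5![apply: (leq_trans (leq_card_setU _ _)); rewrite leq_add2l].
have [w wB|full] := pickP [pred w | w \notin B].
  by exists w; move: wB; rewrite /= !inE !negb_or.
by move: leB; rewrite (eq_card (_ : B =i V)) ?ltnn // => w; apply/negbFE/full.
Qed.

(* At a vertex of [Z] a colour is lost only when used twice, because such a vertex
   is never itself a colour. *)
Lemma card_not_free (V : finType) (e F : rel V) (Z : {set V}) (T : nat)
    (c : V -> V -> option V) (u : V) :
  greedy_state e F Z T c ->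
  (1 + (u \in Z)) * #|[set w | ~~ free_colour Z c u w]| <=
  #|[set y | isSome (c u y)]| + (u \notin Z) * T.
Proof.
move=> [_ c_val c_cap _].
under eq_finset do rewrite /free_colour -ltnNge.
apply: leq_trans (markov_card _ _) _; rewrite big_split sum_uses leq_add2l /=.
case: (boolP (u \in Z)) => uZ; last by rewrite mul1n; apply: c_cap.
rewrite big1 // => w _; apply/eqP; rewrite cards_eq0; apply/eqP/setP => y.
by rewrite !inE; apply/eqP => /c_val/and3P[_ _]; rewrite uZ.
Qed.

(** In units of [n], the first four terms total less than 0.17. The colours not free at an end
    number at most 0.111 + 1/7 < 0.254 outside [Z], at most 1/2 in [Z], and at most 0.005 each if
    both ends are in [Z]. *)
Lemma greedy_count (n T qu qv z s fu fv cu cv : nat) (uZ vZ : bool) :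
    1000 <= n -> 7 * T <= n -> 1000 * qu <= n -> 1000 * qv <= n ->
    100 * z <= n -> 140 * s <= 22 * n ->
    (1 + uZ) * fu <= cu + ~~ uZ * T -> (1 + vZ) * fv <= cv + ~~ vZ * T ->
    cu <= n -> cv <= n ->
    (~~ uZ -> 1000 * cu <= 111 * n) -> (~~ vZ -> 1000 * cv <= 111 * n) ->
    (uZ -> vZ -> cu <= z /\ cv <= z) ->
  qu + qv + z + s + fu + fv < n.
Proof.
case: uZ vZ => [] [] /= ? ? ? ? ? ? ? ? ? ? du dv ZZ.
- by have [//|//|? ?] := ZZ; clear du dv ZZ; lia.
- by have := dv isT; clear du dv ZZ; lia.
- by have := du isT; clear du dv ZZ; lia.
- by have := du isT; have := dv isT; clear du dv ZZ; lia.
Qed.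

(** Each of the [s] saturated colours accounts for [T.-1] of the [f] uses, and [T.-1] is at least
    [0.14 n] once [n >= 1000]. *)
Lemma saturated_count (n T s f : nat) :
    1000 <= n -> n < 7 * T + 7 -> T.-1 * s <= f -> 1000 * f <= 22 * n * n ->
  140 * s <= 22 * n.
Proof.
move=> n_ge Tlb sf fn.
have Tn : 140 * n <= 1000 * T.-1 by lia.
rewrite -(leq_pmul2r (_ : 0 < n)); last by lia.
rewrite mulnAC (leq_trans _ fn) //; apply: leq_trans (_ : 1000 * T.-1 * s <= _).
  by rewrite leq_mul2r Tn orbT.
by rewrite -mulnA leq_mul2l sf orbT.
Qed.

Lemma greedy_step (V : finType) (e F : rel V) (Z : {set V})
    (c : V -> V -> option V) (u v : V) :
    let n := #|V| in
    1000 <= n -> irreflexive e -> symmetric F -> subrel F e ->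
    (forall x, 1000 * #|[set w | ~~ e x w]| <= n) ->
    100 * #|Z| <= n ->
    (forall x, x \notin Z -> 1000 * #|[set y | F x y]| <= 111 * n) ->
    1000 * (\sum_x #|[set y | F x y]|) <= 22 * n * n ->
    greedy_state e F Z (n %/ 7) c -> F u v -> ~~ c u v ->
    (u \in Z -> v \in Z -> forall x y, c x y -> (x \in Z) && (y \in Z)) ->
  exists c', greedy_state e F Z (n %/ 7) c' /\
    forall x y, isSome (c' x y) = isSome (c x y) ||
      ((x == u) && (y == v) || (x == v) && (y == u)).
Proof.
move=> n n_ge e_irr F_sym sFe few_non small_Z degF_le sumF_le c_state Fuv cuv ZZ_first.
have [c_sym c_val c_cap c_load] := c_state.
set T := n %/ 7 in c_state c_cap *.
have Tlb : n < 7 * T + 7 by rewrite -mulnSr mulnC ltn_ceil.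
have Tub : 7 * T <= n by rewrite mulnC leq_divM.
have neq_uv : u != v by apply: contraTneq Fuv => ->; apply/negP => /sFe; rewrite e_irr.
have deg_c x : #|[set y | isSome (c x y)]| <= #|[set y | F x y]|.
  apply/subset_leq_card/subsetP => y; rewrite !inE.
  by case cxy: (c x y) => [b|] // _; case/and3P: (c_val _ _ _ cxy).
(* A colour used fewer than [T.-1] times can take two more uses within the cap [T]. *)
pose sat := [set w | T.-1 <= \sum_a uses c a w].
have sat_le : 140 * #|sat| <= 22 * n.
  apply: saturated_count n_ge Tlb _ sumF_le.
  apply: leq_trans (markov_card (fun w => \sum_a uses c a w) T.-1) _.
  by rewrite exchange_big; apply: leq_sum => a _; rewrite sum_uses.
have maxF x : #|[set y | isSome (c x y)]| <= n by apply: max_card.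
have degZ x : x \notin Z -> 1000 * #|[set y | isSome (c x y)]| <= 111 * n.
  by move/degF_le; apply: leq_trans; rewrite leq_mul2l deg_c orbT.
have ZZ x : u \in Z -> v \in Z -> #|[set y | isSome (c x y)]| <= #|Z|.
  move=> uZ vZ; apply/subset_leq_card/subsetP => y; rewrite inE.
  by move/(ZZ_first uZ vZ)/andP => [].
have [|w] := @card_setU_bound V [set w | ~~ e u w] [set w | ~~ e v w] Z sat
   [set w | ~~ free_colour Z c u w] [set w | ~~ free_colour Z c v w].
  apply: (greedy_count n_ge Tub (few_non u) (few_non v) small_Z sat_le
    (card_not_free u c_state) (card_not_free v c_state) (maxF u) (maxF v)
    (@degZ u) (@degZ v)) => uZ vZ.
  by split; apply: ZZ.
rewrite !inE !negbK -ltnNge => /and5P[euw evw wZ capw /andP[fu fv]].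
by apply: (@greedy_extend _ e F Z T c u v w) => //; rewrite addn2 -ltn_predRL.
Qed.

(** * A balanced choice of a common neighbour for every edge *)

(** Commutativity makes the colour of an edge independent of its orientation; injectivity lets the
    edges at [u] use [uw] at most once. *)
Lemma exists_commutative_quasigroup (V : finType) :
  exists op : V -> V -> V, commutative op /\ forall u, injective (op u).
Proof.
case cardV : #|V| => [|m].
  by exists (fun u _ => u); split=> [u|u]; have := card0_eq cardV u.
pose f u : 'I_m.+1 := cast_ord cardV (enum_rank u).
pose g (i : 'I_m.+1) : V := enum_val (cast_ord (esym cardV) i).
have gK : cancel g f by move=> i; rewrite /f /g enum_valK cast_ordKV.
have fK : cancel f g by move=> u; rewrite /f /g cast_ordK enum_rankK.
exists (fun u v => g (f u + f v)%R); split=> [u v|u v w]; first by rewrite addrC.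
by move/(can_inj gK)/addrI/(can_inj fK).
Qed.

Lemma balanced_triangle_assignment (V : finType) (e : rel V) :
    symmetric e -> irreflexive e ->
    (forall x, 1000 * #|[set w | ~~ e x w]| <= #|V|) ->
  exists c : V -> V -> V,
    [/\ forall u v, c u v = c v u,
        forall u v, e u v -> e u (c u v) &
        forall u w, #|[set v | e u v && (c u v == w)]| +
                    #|[set v | e w v && (c w v == u)]| <= 3].
Proof.
move=> e_sym e_irr few_non; set n := #|V| in few_non *.
have [n_ge|n_lt] := leqP 1000 n; last first.
  have noV (x : V) : False.
    have := few_non x; have : 0 < #|[set w | ~~ e x w]|.
      by apply/card_gt0P; exists x; rewrite inE e_irr.
    by move=> pos; rewrite leqNgt (leq_trans n_lt) // leq_pmulr.
  by exists (fun u _ => u); split=> u; case: (noV u).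
have [op [opC op_inj]] := exists_commutative_quasigroup V.
(* Failures at the near end [x] number at most [n / 1000], as [op x] is injective; [b x] counts
   those at the far end. The [b x] sum to at most [n^2 / 1000], so the threshold [n / 10] leaves at
   most [n / 100] vertices in [Z]. *)
pose b x := #|[set v | ~~ e v (op x v)]|.
pose Z := [set x | n < 10 * b x].
pose F x y := e x y && [|| x \in Z, y \in Z, ~~ e x (op x y) | ~~ e y (op x y)].
have sum_non : 1000 * (\sum_x #|[set w | ~~ e x w]|) <= n * n.
  by rewrite big_distrr -sum_nat_const leq_sum.
have sum_shift : \sum_x \sum_y (~~ e x (op x y)) = \sum_x #|[set w | ~~ e x w]|.
  apply: eq_bigr => v _; rewrite card_set_sum [RHS](reindex_inj (op_inj v)).
  by [].
have sum_b : \sum_x b x = \sum_x #|[set w | ~~ e x w]|.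
  rewrite -sum_shift exchange_big; apply: eq_bigr => x _ /=.
  by rewrite /b card_set_sum; apply: eq_bigr => v _; rewrite opC.
have small_Z : 100 * #|Z| <= n.
  have : n.+1 * #|Z| <= 10 * \sum_x #|[set w | ~~ e x w]|.
    by rewrite -sum_b big_distrr; apply: markov_card.
  move=> leZ; rewrite -(leq_pmul2r (_ : 0 < n)); last exact: leq_trans n_ge.
  apply: leq_trans sum_non; rewrite -[1000]/(100 * 10) -!mulnA leq_mul2l /=.
  by apply: leq_trans leZ; rewrite mulnC leq_mul2r leqnSn orbT.
have F_sym : symmetric F.
  move=> x y; rewrite /F e_sym opC orbCA; congr (_ && _).
  by do 2 congr (_ || _); rewrite orbC.
have sFe : subrel F e by move=> x y /andP[].
(* The constant is 0.01 for [Z], 0.001 for near failures and 0.1 for far ones. *)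
have degF_le x : x \notin Z -> 1000 * #|[set y | F x y]| <= 111 * n.
  move=> xZ; have : #|[set y | F x y]| <= #|Z| + #|[set w | ~~ e x w]| + b x.
    rewrite -[#|[set w | ~~ e x w]|](card_preimset _ (op_inj x)).
    apply: leq_trans (_ : #|Z :|: (op x @^-1: [set w | ~~ e x w]) :|:
        [set v | ~~ e v (op x v)]| <= _).
      apply/subset_leq_card/subsetP => y; rewrite !inE /F (negPf xZ) /=.
      by case/andP=> _; rewrite inE orbA.
    by apply: leq_trans (leq_card_setU _ _) _; rewrite leq_add2r leq_card_setU.
  move: (few_non x) small_Z xZ; rewrite inE -leqNgt.
  by move: #|_| #|_| #|_| (b x) (n) => ? ? ? ? ?; lia.
(* The constant is 0.01 for each end that may lie in [Z], plus 0.001 for each kind of failure. *)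
have sumF_le : 1000 * (\sum_x #|[set y | F x y]|) <= 22 * n * n.
  have : \sum_x #|[set y | F x y]| <=
      n * #|Z| + n * #|Z| + \sum_x \sum_y (~~ e x (op x y)) + \sum_x b x.
    have sumZ : \sum_x (x \in Z) = #|Z|.
      by rewrite -card_set_sum; apply: eq_card => x; rewrite inE.
    have -> : n * #|Z| + n * #|Z| =
        \sum_x \sum_(y : V) (x \in Z) + \sum_(x : V) \sum_y (y \in Z).
      congr (_ + _); last by rewrite sum_nat_const sumZ.
      by rewrite exchange_big sum_nat_const sumZ.
    rewrite -!big_split; apply: leq_sum => x _ /=.
    rewrite /b !card_set_sum -!big_split; apply: leq_sum => y _ /=.
    by rewrite /F; case: (e x y) (x \in Z) (y \in Z) (e x (op x y)) (e y (op x y)) => [] [] [] [] [].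
  rewrite sum_shift sum_b; move: small_Z sum_non.
  move: #|Z| (\sum_x _) (\sum_x _) => z q f zn qn fn.
  have : 100 * z * n <= n * n by rewrite leq_mul2r zn orbT.
  by lia.
clearbody Z.
have step c u v := @greedy_step V e F Z c u v n_ge e_irr F_sym sFe few_non
  small_Z degF_le sumF_le.
(* Edges inside [Z] go first: later a vertex of [Z] may have lost half of the
   colours, and two such ends could block everything. *)
have [c1 [c1_state c1E]] : exists c, greedy_state e F Z (n %/ 7) c /\
    forall x y, isSome (c x y) = false || [&& F x y, x \in Z & y \in Z].
  pose none (x y : V) : option V := None.
  apply: (@greedy_complete V e F (fun x y => [&& F x y, x \in Z & y \in Z]) Z _ none).
  - by move=> x y; rewrite F_sym; congr (_ && _); rewrite andbC.
  - have uses0 x y : uses none x y = 0.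
      by apply/eqP; rewrite cards_eq0; apply/eqP/setP => w; rewrite !inE.
    split=> // [w|x y]; last by rewrite !uses0.
    by rewrite big1.
  - move=> c u v c_state _ c_dom /and3P[Fuv uZ vZ] cuv.
    by apply: step => // _ _ x y /c_dom/and3P[_ -> ->].
have [c2 [c2_state c2E]] : exists c, greedy_state e F Z (n %/ 7) c /\
    forall x y, isSome (c x y) = c1 x y || F x y.
  apply: (greedy_complete F_sym c1_state) => c u v c_state c1c _ Fuv cuv.
  apply: step => // uZ vZ; case/negP: cuv; apply: c1c.
  by rewrite c1E /= Fuv uZ vZ.
have [c_sym c_val _ c_load] := c2_state.
(* The default [u] is never reached on [F], since [c2] colours all of it. *)
exists (fun u v => if F u v then odflt u (c2 u v) else op u v).
have someF u v : F u v -> exists w, c2 u v = Some w.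
  by move=> Fuv; have := c2E u v; rewrite Fuv orbT; case: (c2 u v) => // w _; exists w.
split=> [u v|u v euv|u w].
- rewrite (F_sym v) c_sym opC; case: ifP => // /someF[w].
  by rewrite c_sym => ->.
- case: ifPn => [/someF[w cuv]|]; first by rewrite cuv; case/and3P: (c_val _ _ _ cuv).
  by rewrite /F euv !negb_or !negbK => /and4P[].
(* All edges at [Z] lie in [F], so kept colours load [uw] at most once from each end outside [Z].
   Recoloured edges load it at most once, or twice if an end is in [Z]: at most three in all. *)
- have count x y : #|[set v | e x v &&
        ((if F x v then odflt x (c2 x v) else op x v) == y)]|
      <= uses c2 x y + (x \notin Z).
    apply: leq_trans (_ : #|[set v | c2 x v == Some y] :|:
        [set v | (x \notin Z) && (op x v == y)]| <= _).
      apply/subset_leq_card/subsetP => v; rewrite !inE => /andP[exv].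
      case: ifPn => [/someF[z ->] /eqP <-|]; first by rewrite eqxx.
      by rewrite /F exv !negb_or => /and4P[-> _ _ _] ->; rewrite orbT.
    apply: leq_trans (leq_card_setU _ _) _; rewrite leq_add2l.
    case: (x \in Z) => /=.
      by rewrite leqn0 cards_eq0; apply/eqP/setP => v; rewrite !inE.
    by apply/card_le1_eqP => v v'; rewrite !inE => /eqP <- /eqP /op_inj.
  apply: leq_trans (leq_add (count u w) (count w u)) _.
  rewrite addnACA; apply: leq_trans (leq_add (c_load u w) (leqnn _)) _.
  by case: (u \in Z) (w \in Z) => [] [].
Qed.

(** * From triangle assignments to proper total weightings *)

Local Open Scope ring_scope.

Lemma edge_endpoints (V : finType) (G : sgraph V) (e : edge G) :
  exists p : V * V, G p.1 p.2 && (val e == [set p.1; p.2]).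
Proof.
by case/imsetP: (valP e) => p; rewrite inE => Gp eE; exists p; rewrite Gp; apply/eqP.
Qed.

Lemma degree_neighbours (V : finType) (G : sgraph V) (i : V) :
  (degree G i <= #|[set v | G i v]|)%N.
Proof.
rewrite /degree -(card_imset _ val_inj).
apply: leq_trans (leq_imset_card (fun v => [set i; v]) _).
apply/subset_leq_card/subsetP => S /imsetP[e]; rewrite inE => ie ->.
have [[x y] /= /andP[Gxy /eqP eE]] := edge_endpoints e.
have : i \in [set x; y] by rewrite -eE.
rewrite eE !inE => /orP[] /eqP ->; apply/imsetP.
  by exists y; rewrite ?inE.
by exists x; rewrite 1?setUC // inE adj_sym.
Qed.

Lemma min_degree_le (V : finType) (G : sgraph V) (i : V) :
  (min_degree G <= degree G i)%N.
Proof.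
rewrite /min_degree; have := mem_index_enum i.
elim: (index_enum V) => // j r IH; rewrite inE big_cons geq_min.
by case/predU1P=> [->|/IH ->]; rewrite ?leqnn ?orbT.
Qed.

Lemma few_non_neighbours (R : realType) (V : finType) (G : sgraph V) :
    999%:R / 1000%:R * #|V|%:R <= (min_degree G)%:R :> R ->
  forall x, (1000 * #|[set w | ~~ G x w]| <= #|V|)%N.
Proof.
move=> min_deg x.
have {}min_deg : (999 * #|V| <= 1000 * min_degree G)%N.
  rewrite -(ler_nat R) !natrM; lra.
have le_deg := leq_trans (min_degree_le G x) (degree_neighbours G x).
have := cardsC [set w | G x w].
have -> : ~: [set w | G x w] = [set w | ~~ G x w] by apply/setP => w; rewrite !inE.
lia.
Qed.

Lemma mem_edges (V : finType) (G : sgraph V) (u v : V) :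
  G u v -> [set u; v] \in edges G.
Proof. by move=> Guv; apply/imsetP; exists (u, v); rewrite ?inE. Qed.

Lemma eq_set2 (T : finType) (a b x y : T) :
  x != y -> [set x; y] = [set a; b] -> (x = a /\ y = b) \/ (x = b /\ y = a).
Proof.
move=> neq_xy eqS.
have /set2P xab : x \in [set a; b] by rewrite -eqS set21.
have /set2P yab : y \in [set a; b] by rewrite -eqS set22.
by case: xab yab neq_xy => -> [] ->; rewrite ?eqxx //; [left | right].
Qed.

Lemma sum_delta (R : pzRingType) (V : finType) (a b : V) (f : V -> R) :
  \sum_v ((v == a)%:R - (v == b)%:R) * f v = f a - f b.
Proof.
have delta x : \sum_v (v == x)%:R * f v = f x.
  by rewrite (bigD1 x) //= eqxx mul1r big1 ?addr0 // => v /negPf ->; rewrite mul0r.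
by under eq_bigr do rewrite mulrBl; rewrite sumrB !delta.
Qed.

(** This is [gram_nullstellensatz] for the differences of weight sums along oriented edges: the
    singleton vertex lists give the constant terms, and the edge lists give the grid. *)
Lemma choosable_of_triangle_assignment (R : realType) (V : finType)
    (G : sgraph V) (N : nat) (c : V -> V -> V) :
    (forall u v, c u v = c v u) -> (forall u v, G u v -> G u (c u v)) ->
    (forall u w, #|[set v | G u v && (c u v == w)]| +
                 #|[set v | G w v && (c w v == u)]| <= N)%N ->
  total_weight_choosable R G 1 N.+1.
Proof.
move=> c_sym c_adj c_load L L_vert L_edge.
have adj_neq u v : G u v -> u != v by apply: contraTneq => ->; rewrite adj_irrefl.
have /fin_all_exists[phiV phiVL] : forall v, exists x, x \in L (inl v).
  by move=> v; apply/fset0Pn; rewrite -cardfs_gt0 L_vert.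
have /fin_all_exists[ends endsP] := @edge_endpoints V G.
pose t i := (ends i).1; pose h i := (ends i).2; pose w i := c (t i) (h i).
have Gth i : G (t i) (h i) by case/andP: (endsP i).
have val_th (i : edge G) : val i = [set t i; h i] by case/andP: (endsP i) => _ /eqP.
have Gtw i : G (t i) (w i) by exact: c_adj.
have Ghw i : G (h i) (w i) by rewrite /w c_sym c_adj // adj_sym.
pose p (i : edge G) : edge G := insubd i [set t i; w i].
pose q (i : edge G) : edge G := insubd i [set h i; w i].
have val_p (i : edge G) : val (p i) = [set t i; w i] by rewrite insubdK // mem_edges.
have val_q (i : edge G) : val (q i) = [set h i; w i] by rewrite insubdK // mem_edges.
pose pts (e : edge G) (k : 'I_N.+1) : R := nth 0 (enum_fset (L (inr e))) k.
pose A (i e : edge G) : R := (t i \in val e)%:R - (h i \in val e)%:R.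
pose g i v : R := (v == t i)%:R - (v == h i)%:R.
(* The distinct values [enum_rank v] keep every factor [y_(t i) - y_(h i)] nonzero. *)
have [|||e|k k_neq0] := @gram_nullstellensatz R _ _ V N.+1 g
    (fun v => (enum_rank v)%:R) A (fun i => phiV (t i) - phiV (h i)) pts p q.
- move=> e k k' /eqP; rewrite nth_uniq ?fset_uniq ?L_edge //.
  by move/eqP/val_inj.
- apply/prodf_neq0 => i _; rewrite sum_delta subr_eq0 eqr_nat.
  by rewrite (inj_eq val_inj) (inj_eq enum_rank_inj) adj_neq.
(* The contributions of the common neighbour [w j] to [p j] and [q j] cancel. *)
- move=> i j; rewrite sum_delta /g /A val_p val_q.
  have mem2 x a b : a != b -> (x \in [set a; b])%:R = (x == a)%:R + (x == b)%:R :> R.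
    move=> neq_ab; rewrite !inE; have [->|_] := eqVneq x a; rewrite ?add0r //.
    by rewrite (negPf neq_ab) addr0.
  by rewrite !mem2 ?adj_neq //; ring.
- rewrite ltnS; apply: leq_trans (c_load (t e) (h e)).
  pose P := [set v | G (t e) v && (c (t e) v == h e)].
  pose Q := [set v | G (h e) v && (c (h e) v == t e)].
  (* An edge [i] with [p i] or [q i] equal to [e] has one end on [e] and the other end of [e] as its
     colour; [D] collects these edges. *)
  pose D : {set {set V}} :=
    [set [set t e; v] | v in P] :|: [set [set h e; v] | v in Q].
  have le_D : (#|D| <= #|P| + #|Q|)%N.
    apply: leq_trans (leq_card_setU _ _) _.
    by apply: leq_add; apply: leq_imset_card.
  have tri x y : G x y -> [set x; c x y] = [set t e; h e] -> [set x; y] \in D.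
    move=> Gxy /eq_set2 [|[xE ch]|[xE ch]]; first exact/adj_neq/c_adj.
      apply/setUP; left; apply/imsetP.
      by exists y; rewrite -?xE // inE -xE Gxy ch eqxx.
    apply/setUP; right; apply/imsetP.
    by exists y; rewrite -?xE // inE -xE Gxy ch eqxx.
  apply: leq_trans le_D; rewrite -(card_imset _ val_inj).
  apply/subset_leq_card/subsetP => S /imsetP[i]; rewrite inE => pq_e ->.
  rewrite val_th; case/orP: pq_e => /eqP pq_e.
    by apply: tri; rewrite // -val_th -pq_e val_p.
  by rewrite setUC; apply: tri; rewrite 1?adj_sym // c_sym -val_th -pq_e val_q.
pose phi (z : V + edge G) := match z with inl v => phiV v | inr e => pts e (k e) end.
have sumE v : weight_sum phi v =
    \sum_(e : edge G) (v \in val e)%:R * pts e (k e) + phiV v.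
  rewrite /weight_sum big_mkcond; congr (_ + _); apply: eq_bigr => e _.
  by rewrite inE; case: (v \in val e); rewrite ?mul1r ?mul0r.
have neq_th i : weight_sum phi (t i) != weight_sum phi (h i).
  rewrite -subr_eq0; apply: contra_neq (k_neq0 i) => diff0.
  rewrite -[RHS]diff0 !sumE opprD addrACA -sumrB addrC; congr (_ + _).
  by apply: eq_bigr => e _; rewrite mulrBl.
exists phi; split=> [u v Guv|[v|e]]; last 2 first.
- exact: phiVL.
- by apply: mem_nth; rewrite L_edge.
pose i : edge G := Sub [set u; v] (mem_edges Guv).
have := val_th i; rewrite SubK => /esym/eq_set2[|[<- <-]|[<- <-]].
- exact: adj_neq.
- exact/eqP/neq_th.
- by apply/eqP; rewrite eq_sym neq_th.
Qed.

Theorem theorem1p3 (R : realType) (V : finType) (G : sgraph V) (n : nat)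
    (card_V : #|V| = n)
    (min_deg : 999%:R / 1000%:R * n%:R <= (min_degree G)%:R :> R) :
  total_weight_choosable R G 1 4.
Proof.
rewrite -card_V in min_deg.
have [c [c_sym c_adj c_load]] := balanced_triangle_assignment
  (@adj_sym V G) (@adj_irrefl V G) (few_non_neighbours min_deg).
exact: choosable_of_triangle_assignment c_sym c_adj c_load.
Qed.
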